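(* Let $\lambda\in\mathbb R$. The set of planes in $\mathrm{Gr}_2(\mathbb R^4)$ whose Plücker coordinates satisfy $p_{13}-p_{24}=0$ is invariant under the flow of the equation $Z'=A^{(2)}(\lambda,z)Z$ induced on $\bigwedge^2\mathbb R^4$ by $Y'=A(\lambda,z)Y$.
   Context: Setting. Let $f,g\in C^2(\mathbb R)$ and $\alpha,\sigma>0$, and let $\varphi=(\hat u,\hat v)$ be a traveling wave (a function of $z=x-ct$, with speed $c<0$, decaying exponentially to $(0,0)$ as $z\to\pm\infty$) of the system $u_t=u_{xx}+f(u)-\sigma v$, $v_t=v_{xx}+g(v)+\alpha u$. For $\lambda\in\mathbb R$ consider the linear system $Y'=A(\lambda,z)Y$ on $\mathbb R^4$, $'=d/dz$, with $$A(\lambda,z)=\begin{pmatrix}0&0&\sigma&0\\0&0&0&\alpha\\ \frac{\lambda-f'(\hat u(z))}{\sigma}&1&-c&0\\-1&\frac{\lambda-g'(\hat v(z))}{\alpha}&0&-c\end{pmatrix}.$$ $A^{(2)}(\lambda,z)$ is the unique endomorphism of $\bigwedge^2\mathbb R^4$ with $A^{(2)}(\lambda,z)(Y_1\wedge Y_2)=A(\lambda,z)Y_1\wedge Y_2+Y_1\wedge A(\lambda,z)Y_2$ for all $Y_1,Y_2\in\mathbb R^4$. Thus if $Y_1,Y_2$ solve $Y'=A(\lambda,z)Y$ then $Y_1\wedge Y_2$ solves $Z'=A^{(2)}(\lambda,z)Z$. For a plane $V=\mathrm{span}\{a,b\}\subset\mathbb R^4$, its (projective) Plücker coordinates are $p_{ij}=a_ib_j-a_jb_i$,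 $1\le i<j\le4$, i.e. the coordinates of $a\wedge b$ in the basis $e_i\wedge e_j$; they are defined up to a common nonzero factor. Planes are identified with their images under this embedding $\mathrm{Gr}_2(\mathbb R^4)\to\mathbb P(\bigwedge^2\mathbb R^4)$, so that the equation $Z'=A^{(2)}Z$ induces a flow on planes. *)

(* Defs.v *)
From HB Require Import structures.
From mathcomp Require Import all_boot all_order all_algebra.
From mathcomp Require Import all_classical all_reals all_analysis.
From mathcomp Require Import ring.

Set Implicit Arguments.
Unset Strict Implicit.
Unset Printing Implicit Defensive.

Import Order.TTheory GRing.Theory Num.Theory.
Import numFieldNormedType.Exports.

Local Open Scope ring_scope.
Local Open Scope classical_set_scope.

Section TravelingWave.
Variable R : realType.
Implicit Types (f g uh vh : R -> R) (alpha sigma c : R).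

Definition C2 f : Prop :=
  [/\ forall x, derivable f x 1, forall x, derivable (derive1 f) x 1 &
      continuous (derive1n 2 f)].

(* u_t = u_xx + f(u) - sigma v,  v_t = v_xx + g(v) + alpha u,  in the classical
   sense on the whole plane; arguments are in the order (x, t). *)
Definition solves_system f g alpha sigma (u v : R -> R -> R) : Prop :=
  forall x t,
    [/\ derivable (u x) t 1,
        derivable (u ^~ t) x 1,
        derivable (derive1 (u ^~ t)) x 1 &
        derive1 (u x) t = derive1n 2 (u ^~ t) x + f (u x t) - sigma * v x t] /\
    [/\ derivable (v x) t 1,
        derivable (v ^~ t) x 1,
        derivable (derive1 (v ^~ t)) x 1 &
        derive1 (v x) t = derive1n 2 (v ^~ t) x + g (v x t) + alpha * u x t].

Definition exp_decay (h : R -> R) : Prop :=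
  exists C k : R, 0 < k /\ forall z, `|h z| <= C * expR (- k * `|z|).

Definition traveling_wave f g alpha sigma c uh vh : Prop :=
  [/\ solves_system f g alpha sigma
        (fun x t => uh (x - c * t)) (fun x t => vh (x - c * t)),
      exp_decay uh & exp_decay vh].

Definition Amx f g alpha sigma c uh vh (lambda z : R) : 'M[R]_4 :=
  \matrix_(i < 4, j < 4)
    nth 0 (nth [::]
      [:: [:: 0; 0; sigma; 0];
          [:: 0; 0; 0; alpha];
          [:: (lambda - derive1 f (uh z)) / sigma; 1; - c; 0];
          [:: - 1; (lambda - derive1 g (vh z)) / alpha; 0; - c]] i) j.

End TravelingWave.

Section Plucker.
Variable R : realType.
Implicit Types (a b : 'cV[R]_4) (A : 'M[R]_4) (V : {vspace 'cV[R]_4}).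

(* Indices run over 0..3: [plucker_coord a b i j] is p_{i+1,j+1}. *)
Definition plucker_coord a b (i j : 'I_4) : R :=
  a i 0 * b j 0 - a j 0 * b i 0.

(* The exterior square of R^4 is identified with R^6 by means of the basis
   e_i /\ e_j, i < j, taken in this order. *)
Definition pairs : 6.-tuple ('I_4 * 'I_4) :=
  [tuple (0, 1); (0, 2); (0, 3); (1, 2); (1, 3); (2, 3)].

Definition wedge a b : 'cV[R]_6 :=
  \col_k plucker_coord a b (tnth pairs k).1 (tnth pairs k).2.

Definition basis_vec (i : 'I_4) : 'cV[R]_4 := delta_mx i 0.

(* The matrix of A^(2): its column of index (i, j) is
   A e_i /\ e_j + e_i /\ A e_j.  See [lambda2P] and [lambda2_unique]. *)
Definition lambda2 A : 'M[R]_6 :=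
  \matrix_(k, l)
    let ei := basis_vec (tnth pairs l).1 in
    let ej := basis_vec (tnth pairs l).2 in
    (wedge (A *m ei) ej + wedge ei (A *m ej)) k 0.

Lemma wedge_basis (l : 'I_6) :
  wedge (basis_vec (tnth pairs l).1) (basis_vec (tnth pairs l).2)
    = delta_mx l 0.
Proof.
apply/matrixP => k m; rewrite (ord1 m) !mxE /plucker_coord !mxE.
by case: k => [[|[|[|[|[|[|//]]]]]] hk]; case: l => [[|[|[|[|[|[|//]]]]]] hl];
  rewrite !(tnth_nth (0, 0)) /= ?mulr0 ?mul0r ?mulr1 ?subr0 ?subrr.
Qed.

Lemma wedge_anti a b : wedge b a = - wedge a b.
Proof. by apply/matrixP => k m; rewrite !mxE /plucker_coord; ring. Qed.

Lemma wedge_is_linear_l b : linear (wedge^~ b).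
Proof.
by move=> s a a'; apply/matrixP => k m; rewrite !mxE /plucker_coord !mxE; ring.
Qed.

Lemma wedge_is_linear_r a : linear (wedge a).
Proof.
by move=> s b b'; apply/matrixP => k m; rewrite !mxE /plucker_coord !mxE; ring.
Qed.

(* An alternating bilinear map is determined by its values on the basis. *)
Lemma alternating_expand n (F : 'cV[R]_4 -> 'cV[R]_4 -> 'cV[R]_n) a b :
    (forall b, linear (F^~ b)) -> (forall a b, F b a = - F a b) ->
  F a b = \sum_(l < 6) wedge a b l 0 *:
            F (basis_vec (tnth pairs l).1) (basis_vec (tnth pairs l).2).
Proof.
move=> Fl Fa.
have FE x y : F x y = \sum_(i < 4) x i 0 *: F (basis_vec i) y.
  pose L := GRing.isLinear.Build _ _ _ _ _ (Fl y).
  pose FL : {linear 'cV[R]_4 -> 'cV[R]_n} := HB.pack (F^~ y) L.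
  rewrite -[LHS]/(FL x) {1}[x]matrix_sum_delta linear_sum.
  by apply: eq_bigr => i _; rewrite big_ord1 linearZ.
have FE2 x y : F x y =
    \sum_(i < 4) \sum_(j < 4) (x i 0 * y j 0) *: F (basis_vec i) (basis_vec j).
  rewrite FE; apply: eq_bigr => i _; rewrite Fa FE -sumrN scaler_sumr.
  by apply: eq_bigr => j _; rewrite (Fa (basis_vec j)) !scalerN scalerA.
have Fd x : F x x = 0.
  have /eqP := Fa x x; rewrite -addr_eq0 -mulr2n -scaler_nat scaler_eq0.
  by rewrite pnatr_eq0 => /eqP.
rewrite FE2; apply/matrixP => k m; rewrite (ord1 m) !summxE.
under eq_bigr do rewrite summxE.
under [RHS]eq_bigr do rewrite !mxE /plucker_coord.
pose G i j := F (basis_vec i) (basis_vec j) k 0.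
have Gd i : G i i = 0 by rewrite /G Fd mxE.
have Ga i j : G j i = - G i j by rewrite /G Fa mxE.
under eq_bigr do under eq_bigr do rewrite mxE -/(G _ _).
under [RHS]eq_bigr do rewrite -/(G _ _).
have sum4 (h : 'I_4 -> R) : \sum_i h i = h 0 + h 1 + h 2 + h 3.
  rewrite !big_ord_recl big_ord0 addr0 !addrA.
  by congr (h _ + h _ + h _ + h _); apply: val_inj.
rewrite !sum4 !big_ord_recl big_ord0 !(tnth_nth (0, 0)) /= !Gd.
rewrite (Ga 0 1) (Ga 0 2) (Ga 0 3) (Ga 1 2) (Ga 1 3) (Ga 2 3).
ring.
Qed.

Lemma lambda2P A a b :
  lambda2 A *m wedge a b = wedge (A *m a) b + wedge a (A *m b).
Proof.
pose F a b := wedge (A *m a) b + wedge a (A *m b).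
rewrite -/(F a b) (alternating_expand (F := F)).
- apply/matrixP => k m; rewrite (ord1 m) !mxE summxE.
  by apply: eq_bigr => l _; rewrite !mxE /= mulrC !mxE.
- move=> {a}b s a a'; rewrite /F mulmxDr -scalemxAr !wedge_is_linear_l.
  by rewrite scalerDr addrACA.
- by move=> x y; rewrite /F wedge_anti (wedge_anti (A *m x)) -opprD addrC.
Qed.

Lemma lambda2_unique A (B : 'M[R]_6) :
    (forall a b, B *m wedge a b = wedge (A *m a) b + wedge a (A *m b)) ->
  B = lambda2 A.
Proof.
move=> HB; apply/matrixP => k l.
have: B *m delta_mx l 0 = lambda2 A *m (delta_mx l 0 : 'cV[R]_6).
  by rewrite -wedge_basis HB lambda2P.
by rewrite -!colE => /matrixP /(_ k 0); rewrite !mxE.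
Qed.

(* The projective space of Lambda^2 R^4 is the set of lines of R^6.
   Meaningful for [\dim V = 2] only; see [pluckerE]. *)
Definition plucker V : {vspace 'cV[R]_6} :=
  <[wedge (vbasis V)`_0 (vbasis V)`_1]>%VS.

Lemma pluckerE V a b : basis_of V [:: a; b] -> plucker V = <[wedge a b]>%VS.
Proof.
move=> Vab; rewrite /plucker.
have dV : \dim V = 2%N by rewrite (size_basis (X := [tuple a; b]) Vab).
have Vxy : basis_of V [:: (vbasis V)`_0; (vbasis V)`_1].
  have := vbasisP V; have := etrans (size_tuple (vbasis V)) dV.
  by case: (tval _) => [|x [|y []]].
have sub x y x' y' : basis_of V [:: x; y] -> basis_of V [:: x'; y'] ->
    (<[wedge x' y']> <= <[wedge x y]>)%VS.
  move=> B B'; rewrite -memvE.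
  have [] : x' \in V /\ y' \in V.
    by split; apply: (basis_mem B'); rewrite !inE eqxx ?orbT.
  rewrite -(span_basis B) !span_cons span_nil addv0.
  move=> /memv_addP[_ /vlineP[p ->] [_ /vlineP[q ->] ->]].
  move=> /memv_addP[_ /vlineP[r ->] [_ /vlineP[s ->] ->]].
  apply/vlineP; exists (p * s - q * r).
  by apply/matrixP => k m; rewrite !mxE /plucker_coord !mxE; ring.
by apply/eqP; rewrite eqEsubv !sub.
Qed.

Definition planes_p13_eq_p24 : set {vspace 'cV[R]_4} :=
  [set V | \dim V = 2%N /\
    forall a b, basis_of V [:: a; b] ->
      plucker_coord a b 0 2 - plucker_coord a b 1 3 = 0].

End Plucker.

Section Flow.
Variable R : realType.
Implicit Types (B : R -> 'M[R]_6) (P Q : {vspace 'cV[R]_6}).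

(* The flow from time [z0] to time [z1] induced on the lines of R^6 by the
   non-autonomous linear equation Z' = B(z) Z, as a relation; neither
   z0 <= z1 nor z1 <= z0 is assumed. *)
Definition proj_flow B (z0 z1 : R) P Q : Prop :=
  exists Z : R -> 'cV[R]_6,
    [/\ forall z : R, is_derive z (1 : R) Z (B z *m Z z),
        Z z0 != 0, P = <[Z z0]>%VS & Q = <[Z z1]>%VS].

Definition flow_invariant B (S : set {vspace 'cV[R]_6}) : Prop :=
  forall z0 z1 P Q, proj_flow B z0 z1 P Q -> S P -> S Q.

End Flow.

(* Main.v *)
Require Import Defs.
From mathcomp Require Import all_boot all_order all_algebra.
From mathcomp Require Import all_classical all_reals all_analysis.
From mathcomp Require Import ring lra.
Import Order.TTheory GRing.Theory Num.Theory.
Import numFieldNormedType.Exports.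
Local Open Scope ring_scope.
Local Open Scope classical_set_scope.

(* Along a solution of Z' = A^(2) Z one has p13' = p12 - c p13 and
   p24' = p12 - c p24, so p13 - p24 solves y' = - c y, while the Pluecker
   quadric q = p12 p34 - p13 p24 + p14 p23 solves q' = tr(A) q = - 2 c q.  Both
   therefore vanish identically once they vanish at one time.  Uniqueness for
   the linear equation, whose coefficients are continuous because the wave
   profile and f', g' are, keeps Z nonzero, and a nonzero vector of the quadric
   is decomposable: it is proportional to the wedge of two rows of the
   skew-symmetric matrix (p_ij). *)

Lemma ord6P (P : 'I_6 -> Prop) :
  P 0 -> P 1 -> P 2 -> P 3 -> P 4 -> P 5 -> forall k, P k.
Proof.
move=> P0 P1 P2 P3 P4 P5 [[|[|[|[|[|[|//]]]]]] hk].
- by rewrite (_ : Ordinal hk = 0) //; apply: val_inj.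
- by rewrite (_ : Ordinal hk = 1) //; apply: val_inj.
- by rewrite (_ : Ordinal hk = 2) //; apply: val_inj.
- by rewrite (_ : Ordinal hk = 3) //; apply: val_inj.
- by rewrite (_ : Ordinal hk = 4) //; apply: val_inj.
- by rewrite (_ : Ordinal hk = 5) //; apply: val_inj.
Qed.

Lemma sum_ord6 (V : nmodType) (h : 'I_6 -> V) :
  \sum_i h i = h 0 + h 1 + h 2 + h 3 + h 4 + h 5.
Proof.
rewrite !big_ord_recl big_ord0 addr0 !addrA.
by congr (h _ + h _ + h _ + h _ + h _ + h _); apply: val_inj.
Qed.

(** * Gronwall estimates and uniqueness for linear equations *)

Section Gronwall.
Set Implicit Arguments.
Unset Strict Implicit.
Variable R : realType.
Implicit Types (u du b : R -> R) (x y : R).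

(** With [b m] the maximum of [b] on [x, y], the nonnegative function u^2 exp(-2 (b m) t) is
    nonincreasing there and starts at 0. *)
Lemma gronwall_eq0_le u du b x y : x <= y ->
  (forall t, is_derive t (1 : R) u (du t)) -> continuous b ->
  (forall t, `|du t| <= b t * `|u t|) -> u x = 0 -> u y = 0.
Proof.
move=> xy uD bC dub ux0.
have [m _ bm] := EVT_max xy (continuous_subspaceT bC).
pose w t := u t ^+ 2 * expR (- (b m *+ 2) * t).
pose dw t := (u t * du t - b m * u t ^+ 2) *+ 2 * expR (- (b m *+ 2) * t).
have wD t : is_derive t (1 : R) w (dw t).
  have e : is_derive t (1 : R) (fun s => expR (- (b m *+ 2) * s))
      (expR (- (b m *+ 2) * t) * - (b m *+ 2)).
    apply: is_derive1_comp => /=.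
    by have := is_deriveZ (f := id) (- (b m *+ 2)) (is_derive_id t (1 : R));
       rewrite /GRing.scale /= mulr1.
  have we := is_deriveM (is_deriveX 2 (uD t)) e.
  apply: (is_derive_eq we); rewrite /dw /GRing.scale /= fctE; ring.
have w_le : w y <= w x.
  have wC : {within `[x, y], continuous w}.
    apply: continuous_subspaceT => t; apply/differentiable_continuous.
    by apply/derivable1_diffP; exact: ex_derive.
  apply: (ler0_derive1_le_cc _ _ wC); rewrite ?in_itv/= ?lexx ?xy // => t txy.
  rewrite derive1E derive_val /dw pmulr_lle0 ?expR_gt0 // pmulrn_lle0 // subr_le0.
  apply: (le_trans (ler_norm _)); rewrite normrM.
  apply: (le_trans (ler_wpM2l (normr_ge0 _) (dub t))).
  rewrite mulrCA -expr2 real_normK ?num_real //.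
  apply: ler_wpM2r; first exact: sqr_ge0.
  by apply: bm; apply: subset_itv_oo_cc.
move: w_le; rewrite /w ux0 expr0n mul0r => w_le.
have : u y ^+ 2 <= 0 by rewrite -(pmulr_lle0 _ (expR_gt0 (- (b m *+ 2) * y))).
by move=> h; apply/eqP; rewrite -sqrf_eq0 eq_le h sqr_ge0.
Qed.

Lemma gronwall_eq0 u du b x y :
  (forall t, is_derive t (1 : R) u (du t)) -> continuous b ->
  (forall t, `|du t| <= b t * `|u t|) -> u x = 0 -> u y = 0.
Proof.
move=> uD bC dub ux0; have [xy|/ltW yx] := leP x y.
  exact: (gronwall_eq0_le xy uD bC dub ux0).
(* Time reversal t -> -t turns y < x into - x <= - y. *)
rewrite -[y]opprK.
apply: (@gronwall_eq0_le (u \o -%R) (fun t => - du (- t)) (b \o -%R) (- x)).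
- by rewrite lerN2.
- move=> t; have := is_derive1_comp (uD (- t)) (is_deriveNid t (1 : R)).
  by rewrite mulrN1.
- by move=> t; apply: continuous_comp; [exact: opp_continuous|exact: bC].
- by move=> t; rewrite normrN; exact: dub.
- by rewrite /= opprK.
Qed.

Lemma is_derive_coord m n (Z : R -> 'M[R]_(m, n)) dZ t i j :
  is_derive t (1 : R) Z dZ -> is_derive t (1 : R) (fun s => Z s i j) (dZ i j).
Proof.
case=> Zd <-; have Zij := (derivable_mxP _ _ _).1 Zd i j.
by apply: DeriveDef => //; rewrite derive_mx // mxE.
Qed.

(** The squared Euclidean norm u of Z satisfies |u'| <= b u, where b is twice the sum of the |B i
    j|, so the scalar Gronwall lemma applies to u. *)
Lemma linear_ode_eq0 n (B : R -> 'M[R]_n) (Z : R -> 'cV[R]_n) x y :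
  (forall i j, continuous (fun t => B t i j)) ->
  (forall t, is_derive t (1 : R) Z (B t *m Z t)) -> Z x = 0 -> Z y = 0.
Proof.
move=> BC ZD Zx0.
pose u t := \sum_(i < n) Z t i 0 ^+ 2.
pose du t := \sum_(i < n) (Z t i 0 * (B t *m Z t) i 0) *+ 2.
pose b t := (\sum_(i < n) \sum_(j < n) `|B t i j|) *+ 2.
have u_ge0 t : 0 <= u t by apply: sumr_ge0 => i _; exact: sqr_ge0.
have uD t : is_derive t (1 : R) u (du t).
  have -> : u = \sum_(i < n) (fun s => Z s i 0 ^+ 2).
    by apply/funext => s; rewrite fct_sumE.
  apply: is_derive_sum => i.
  have Z2 := is_deriveX 2 (is_derive_coord i 0 (ZD t)).
  by apply: (is_derive_eq Z2); rewrite /GRing.scale /= -mulrA mulr_natl expr1.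
have bC : continuous b.
  move=> t; rewrite /b; under eq_fun do rewrite -mulr_natl.
  apply: cvgM; first exact: cvg_cst.
  apply: cvg_big => [|i _]; first exact: add_continuous.
  apply: cvg_big => [|j _]; first exact: add_continuous.
  apply: cvg_norm; exact: BC.
suff dub t : `|du t| <= b t * `|u t|.
  have /eqP : u y = 0.
    by apply: (gronwall_eq0 (x := x) y uD bC dub); rewrite /u Zx0 big1 // => i _;
       rewrite mxE expr0n.
  rewrite psumr_eq0 => [/allP h|i _]; last exact: sqr_ge0.
  apply/matrixP => i j; rewrite (ord1 j) mxE; apply/eqP.
  by rewrite -sqrf_eq0; apply: h; rewrite mem_index_enum.
(* From 2pq <= p^2 + q^2, where both squares are at most u. *)
have Zu i j : `|Z t i 0| * `|Z t j 0| <= u t.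
  have sq k : `|Z t k 0| ^+ 2 <= u t.
    rewrite real_normK ?num_real // /u (bigD1 k) //= lerDl.
    by apply: sumr_ge0 => l _; exact: sqr_ge0.
  have := sq i; have := sq j; move: `|Z t i 0| `|Z t j 0| => p q.
  have := sqr_ge0 (p - q); nra.
rewrite /du sumrMnl normrMn (ger0_norm (u_ge0 t)) /b mulrnAl lerMn2r /=.
rewrite (le_trans (ler_norm_sum _ _ _)) // mulr_suml ler_sum // => i _.
rewrite normrM mxE (le_trans (ler_wpM2l _ (ler_norm_sum _ _ _))) //.
rewrite mulr_sumr mulr_suml ler_sum // => j _.
by rewrite normrM mulrCA ler_wpM2l.
Qed.

End Gronwall.

(** * The Plücker quadric and the image of the Plücker embedding *)

Section Lambda2.
Set Implicit Arguments.
Unset Strict Implicit.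
Variable R : realType.
Implicit Types (A : 'M[R]_4) (Z : 'cV[R]_6).

Lemma lambda2E A k l
    (p := (tnth pairs k).1) (q := (tnth pairs k).2)
    (i := (tnth pairs l).1) (j := (tnth pairs l).2) :
  lambda2 A k l = A p i * (q == j)%:R - A q i * (p == j)%:R
                + ((p == i)%:R * A q j - (q == i)%:R * A p j).
Proof.
by rewrite !mxE /= !mxE /plucker_coord /basis_vec -!colE !mxE /= !andbT.
Qed.

(** In the order of [pairs], the indices 0, ..., 5 stand for p12, p13, p14, p23, p24, p34. *)
Definition plucker_quad Z :=
  Z 0 0 * Z 5 0 - Z 1 0 * Z 4 0 + Z 2 0 * Z 3 0.

(** The left side is the derivative of the quadric q in the direction W. Since Z /\ Z is 2q times
    the volume form, and A acts as a derivation on the top exterior power by its trace, the factor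
    is tr A. *)
Lemma plucker_quad_lambda2 A Z (W := lambda2 A *m Z) :
  W 0 0 * Z 5 0 + Z 0 0 * W 5 0 - (W 1 0 * Z 4 0 + Z 1 0 * W 4 0)
    + (W 2 0 * Z 3 0 + Z 2 0 * W 3 0) = \tr A * plucker_quad Z.
Proof.
have trA : \tr A = A 0 0 + A 1 1 + A 2 2 + A 3 3.
  rewrite /mxtrace !big_ord_recl big_ord0 addr0 !addrA.
  by congr (A _ _ + A _ _ + A _ _ + A _ _); apply: val_inj.
rewrite /W trA /plucker_quad.
rewrite !(mxE mulmx_key) !sum_ord6.
rewrite !lambda2E !(tnth_nth (0, 0)) /=.
ring.
Qed.

Lemma wedge_quad a b : plucker_quad (wedge a b : 'cV[R]_6) = 0.
Proof.
rewrite /plucker_quad !mxE /plucker_coord !(tnth_nth (0, 0)) /=; ring.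
Qed.

(** The skew-symmetric matrix (p_ij). For Z = a /\ b its row i is a_i b - b_i a, so its rows lie in
    the plane of a and b. *)
Definition skew_of Z : 'M[R]_4 :=
  \matrix_(i, j) nth 0 (nth [::]
    [:: [:: 0; Z 0 0; Z 1 0; Z 2 0];
        [:: - Z 0 0; 0; Z 3 0; Z 4 0];
        [:: - Z 1 0; - Z 3 0; 0; Z 5 0];
        [:: - Z 2 0; - Z 4 0; - Z 5 0; 0]] i) j.

(** For Z = a /\ b, expanding (a_i b - b_i a) /\ (a_j b - b_j a) gives p_ij Z; in coordinates this
    identity needs only the quadric relation. *)
Lemma wedge_skew_of Z k : plucker_quad Z = 0 ->
  wedge (row (tnth pairs k).1 (skew_of Z))^T (row (tnth pairs k).2 (skew_of Z))^T
    = Z k 0 *: Z.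
Proof.
rewrite /plucker_quad => Q0.
(* The monomial p12 p34 is isolated so that [ring: Q0] can eliminate it. *)
have {}Q0 : Z 0 0 * Z 5 0 = Z 1 0 * Z 4 0 - Z 2 0 * Z 3 0 by move: Q0; lra.
apply/matrixP => l m; rewrite (ord1 m) !mxE /plucker_coord !mxE.
elim/ord6P: k; elim/ord6P: l; rewrite !(tnth_nth (0, 0)) /=; ring: Q0.
Qed.

Lemma plucker_quad_decomp Z : plucker_quad Z = 0 -> Z != 0 ->
  exists a b, Z = wedge a b.
Proof.
move=> Q0 /matrix0Pn[k [j]]; rewrite (ord1 j) => Zk.
(* The two rows wedge to [Z k 0 *: Z], so one of them is divided by the nonzero coordinate
   [Z k 0]. *)
exists ((Z k 0)^-1 *: (row (tnth pairs k).1 (skew_of Z))^T).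
exists (row (tnth pairs k).2 (skew_of Z))^T.
have := wedge_is_linear_l (row (tnth pairs k).2 (skew_of Z))^T (Z k 0)^-1
  (row (tnth pairs k).1 (skew_of Z))^T 0.
rewrite addr0 wedge_skew_of // scalerA mulVf // scale1r => ->.
rewrite (_ : wedge 0 _ = 0) ?addr0 //.
by apply/matrixP => l m; rewrite !mxE /plucker_coord !mxE !mul0r subrr.
Qed.

Lemma wedge_neq0_basis (a b : 'cV[R]_4) : wedge a b != 0 ->
  basis_of <<[:: a; b]>>%VS [:: a; b].
Proof.
move=> ab0; rewrite /basis_of eqxx /= free_cons span_seq1 seq1_free.
apply/andP; split; apply: contra_neqN ab0.
  by move=> /vlineP[s ->]; apply/matrixP => k m;
     rewrite !mxE /plucker_coord !mxE; ring.
by move=> /eqP ->; apply/matrixP => k m;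
   rewrite !mxE /plucker_coord !mxE !mulr0 subrr.
Qed.

Lemma basis_of_dim2 (V : {vspace 'cV[R]_4}) : \dim V = 2%N ->
  exists a b, basis_of V [:: a; b].
Proof.
move=> dV; have := vbasisP V; have := etrans (size_tuple (vbasis V)) dV.
by case: (tval _) => [|a [|b []]] // _ ab; exists a, b.
Qed.

(** Reduces invariance to two scalar equations along a solution. Both are homogeneous, hence
    independent of the generator of the line; the converse rests on decomposability. *)
Lemma plucker_image Z : Z != 0 ->
  (@plucker R @` @planes_p13_eq_p24 R) <[Z]>%VS <->
  plucker_quad Z = 0 /\ Z 1 0 - Z 4 0 = 0.
Proof.
have w1 a b : wedge a b 1 0 = plucker_coord a b 0 2 :> R.
  by rewrite mxE (tnth_nth (0, 0)).
have w4 a b : wedge a b 4 0 = plucker_coord a b 1 3 :> R.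
  by rewrite mxE (tnth_nth (0, 0)).
move=> Z0; split.
  move=> [V [dV pV] VZ]; have [a [b ab]] := basis_of_dim2 dV.
  have /vlineP[s ->] : Z \in <[wedge a b]>%VS.
    by rewrite -(pluckerE ab) VZ memv_line.
  have := wedge_quad a b; have := pV a b ab; rewrite -w1 -w4 => d0 q0.
  have sE k : (s *: wedge a b) k 0 = s * wedge a b k 0 by rewrite mxE.
  split; last by rewrite !sE -mulrBr d0 mulr0.
  transitivity (s ^+ 2 * plucker_quad (wedge a b)); last by rewrite q0 mulr0.
  by rewrite /plucker_quad !sE; ring.
move=> [q0 d0]; have [a [b Zab]] := plucker_quad_decomp q0 Z0.
have abV : basis_of <<[:: a; b]>>%VS [:: a; b].
  by apply: wedge_neq0_basis; rewrite -Zab.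
exists <<[:: a; b]>>%VS; last by rewrite (pluckerE abV) Zab.
split; first by rewrite (size_basis (X := [tuple a; b]) abV).
move=> a' b' ab'; rewrite -w1 -w4.
have /vlineP[s ->] : wedge a' b' \in <[Z]>%VS.
  by rewrite Zab -(pluckerE abV) (pluckerE ab') memv_line.
have sE k : (s *: Z) k 0 = s * Z k 0 by rewrite mxE.
by rewrite !sE -mulrBr d0 mulr0.
Qed.

End Lambda2.

(** * The coefficient matrix along the wave *)

Section TravelingWave.
Set Implicit Arguments.
Unset Strict Implicit.
Variables (R : realType) (f g : R -> R) (alpha sigma c : R) (uh vh : R -> R).
Variable lambda : R.
Let A := Amx f g alpha sigma c uh vh lambda.

Lemma mxtrace_Amx z : \tr (A z) = - c *+ 2.
Proof.
by rewrite /mxtrace !big_ord_recl big_ord0 !mxE /= !add0r addr0 mulr2n.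
Qed.

(** The entries 1 and -1 in the lower left block of A each contribute p12, once to p13' and once to
    p24', which cancels in the difference. *)
Lemma p13_sub_p24_lambda2 z (Z : 'cV[R]_6) : alpha != 0 -> sigma != 0 ->
  (lambda2 (A z) *m Z) 1 0 - (lambda2 (A z) *m Z) 4 0 = - c * (Z 1 0 - Z 4 0).
Proof.
move=> alpha0 sigma0; rewrite !(mxE mulmx_key) !sum_ord6.
rewrite !lambda2E !(tnth_nth (0, 0)) /= /A !mxE /=; ring.
Qed.

(** At time 0 the wave coincides with its profile, and a classical solution is differentiable in
    x. *)
Lemma traveling_wave_continuous : c != 0 ->
  traveling_wave f g alpha sigma c uh vh -> continuous uh /\ continuous vh.
Proof.
move=> c0 [sol _ _].
have cont (h : R -> R) :
    (forall x, derivable (fun y => h (y - c * 0)) x 1) -> continuous h.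
  under eq_fun do rewrite mulr0 subr0.
  by move=> hD x; apply/differentiable_continuous/derivable1_diffP.
by split; apply: cont => x; have [[_ uD _ _] [_ vD _ _]] := sol x 0;
  [exact: uD | exact: vD].
Qed.

Lemma continuous_Amx i j : c != 0 -> C2 f -> C2 g ->
  traveling_wave f g alpha sigma c uh vh -> continuous (fun z => A z i j).
Proof.
move=> c0 [_ fD _] [_ gD _] /(traveling_wave_continuous c0)[uC vC].
have ent (h w : R -> R) k : (forall x, derivable (derive1 h) x 1) ->
    continuous w -> continuous (fun z => (lambda - derive1 h (w z)) / k).
  move=> hD wC z; apply: cvgM; last exact: cvg_cst.
  apply: cvgB; first exact: cvg_cst.
  apply: (continuous_comp (wC z)).
  by apply/differentiable_continuous/derivable1_diffP.
rewrite (_ : (fun z => A z i j) = fun z => nth 0 (nth [::]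
      [:: [:: 0; 0; sigma; 0];
          [:: 0; 0; 0; alpha];
          [:: (lambda - derive1 f (uh z)) / sigma; 1; - c; 0];
          [:: - 1; (lambda - derive1 g (vh z)) / alpha; 0; - c]] i) j).
  by case: i => [[|[|[|[|//]]]] hi]; case: j => [[|[|[|[|//]]]] hj] /=;
     (exact: ent || exact: cst_continuous).
by apply/funext => z; rewrite mxE.
Qed.

Lemma continuous_lambda2 (M : R -> 'M[R]_4) k l :
  (forall i j, continuous (fun z => M z i j)) ->
  continuous (fun z => lambda2 (M z) k l).
Proof.
move=> MC z; under eq_fun do rewrite lambda2E.
by apply: cvgD; apply: cvgB; apply: cvgM; (exact: MC || exact: cvg_cst).
Qed.

End TravelingWave.

Theorem lemma2 (R : realType) (f g : R -> R) (alpha sigma c : R)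
    (uh vh : R -> R) (lambda : R)
    (f_C2 : C2 f) (g_C2 : C2 g)
    (alpha_gt0 : 0 < alpha) (sigma_gt0 : 0 < sigma) (c_lt0 : c < 0)
    (wave : traveling_wave f g alpha sigma c uh vh) :
  flow_invariant
    (fun z => lambda2 (Amx f g alpha sigma c uh vh lambda z))
    (@plucker R @` @planes_p13_eq_p24 R).
Proof.
have c0 : c != 0 by rewrite lt_eqF.
have alpha0 : alpha != 0 by rewrite gt_eqF.
have sigma0 : sigma != 0 by rewrite gt_eqF.
move=> z0 z1 P Q [Z [ZD Z0 -> ->]] /(plucker_image Z0)[q0 d0].
(* Uniqueness is applied from [z1] to [z0]: a zero at [z1] would force [Z z0 = 0]. *)
have Z1 : Z z1 != 0.
  apply: contra_neq Z0; apply: linear_ode_eq0 ZD => i j.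
  by apply: continuous_lambda2 => p q; exact: continuous_Amx.
have ZijD z i := is_derive_coord i 0 (ZD z).
apply/(plucker_image Z1); split.
  have qD z : is_derive z (1 : R) (fun s => plucker_quad (Z s))
      (- c *+ 2 * plucker_quad (Z z)).
    have qD := is_deriveD (is_deriveB (is_deriveM (ZijD z 0) (ZijD z 5))
      (is_deriveM (ZijD z 1) (ZijD z 4))) (is_deriveM (ZijD z 2) (ZijD z 3)).
    apply: (is_derive_eq qD).
    rewrite -(mxtrace_Amx f g alpha sigma c uh vh lambda z).
    by rewrite -plucker_quad_lambda2 /GRing.scale /=; ring.
  (* A scalar equation q' = k q satisfies the Gronwall bound with the constant coefficient |k|. *)
  apply: (gronwall_eq0 (b := cst `|- c *+ 2|) z1 qD _ _ q0).
    exact: cst_continuous.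
  by move=> t; rewrite normrM.
have dD z : is_derive z (1 : R) (fun s => Z s 1 0 - Z s 4 0)
    (- c * (Z z 1 0 - Z z 4 0)).
  rewrite -(p13_sub_p24_lambda2 f g c uh vh lambda z _ alpha0 sigma0).
  exact: is_deriveB (ZijD z 1) (ZijD z 4).
apply: (gronwall_eq0 (b := cst `|- c|) z1 dD _ _ d0).
  exact: cst_continuous.
by move=> t; rewrite normrM.
Qed.
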